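(* Let $(X,f,x_0)$ be a counting system, i.e. $X$ is a set, $f : X \to X$ is a mapping and $x_0 \in X$. Then there exists a unique iterator $\#$ for $(X,f,x_0)$; that is, there is exactly one assignment $A \mapsto \#(A)$ of an element $\#(A) \in X$ to each finite set $A$ such that $\#(\varnothing) = x_0$ and $\#(A \cup \{a\}) = f(\#(A))$ whenever $A$ is a finite set and $a \notin A$.
   Context: Finiteness is defined without natural numbers. For a set $A$ let $\mathcal{P}(A)$ denote its power set. A subset $\mathcal{K} \subset \mathcal{P}(A)$ is an inductive system in $\mathcal{P}(A)$ if $\varnothing \in \mathcal{K}$ and $B \cup \{a\} \in \mathcal{K}$ for all $B \in \mathcal{K}$ and $a \in A \setminus B$. A set $A$ is finite if $\mathcal{P}(A)$ itself is the only inductive system in $\mathcal{P}(A)$. The assignment $\#$ is defined on all finite sets (sets are those of ordinary set theory). *)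

(* Defs.v *)
From Stdlib Require Import Classical.

Set Implicit Arguments.
Unset Strict Implicit.
Unset Printing Implicit Defensive.

(* "Ordinary set theory": a universe of sets satisfying the axioms of ZF.
   Separation and replacement range over arbitrary Rocq predicates and
   functions, which therefore play the role of classes and class functions.
   The set-building operations are fields rather than existential axioms; by
   extensionality each is determined by its membership specification. *)
Record zf_universe := ZFUniverse {
  set :> Type;
  mem : set -> set -> Prop;
  empty : set;
  pair : set -> set -> set;
  bigunion : set -> set;
  power : set -> set;
  separation : set -> (set -> Prop) -> set;
  replacement : set -> (set -> set) -> set;
  extensionality : forall A B, (forall x, mem x A <-> mem x B) -> A = B;
  mem_empty : forall x, ~ mem x empty;
  mem_pair : forall a b x, mem x (pair a b) <-> x = a \/ x = b;
  mem_bigunion : forall A x,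
    mem x (bigunion A) <-> exists y, mem y A /\ mem x y;
  mem_power : forall A B,
    mem B (power A) <-> forall x, mem x B -> mem x A;
  mem_separation : forall A P x, mem x (separation A P) <-> mem x A /\ P x;
  mem_replacement : forall A F y,
    mem y (replacement A F) <-> exists x, mem x A /\ y = F x;
  infinity : exists W, mem empty W /\
    forall x, mem x W -> mem (bigunion (pair x (pair x x))) W;
  foundation : forall A, (exists x, mem x A) ->
    exists x, mem x A /\ forall y, mem y A -> ~ mem y x
}.

Arguments empty {z}.

Declare Scope zf_scope.
Delimit Scope zf_scope with zf.
Open Scope zf_scope.

Notation "x ∈ A" := (mem x A) (at level 70, no associativity) : zf_scope.
Notation "x ∉ A" := (~ mem x A) (at level 70, no associativity) : zf_scope.
Notation "A ⊆ B" := (forall x, x ∈ A -> x ∈ B)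
  (at level 70, no associativity, only parsing) : zf_scope.
Notation "∅" := empty : zf_scope.

Definition singleton (V : zf_universe) (a : V) : V := pair a a.
Definition union (V : zf_universe) (A B : V) : V := bigunion (pair A B).

Notation "A ∪ B" := (union A B) (at level 50, left associativity) : zf_scope.

Definition inductive_system (V : zf_universe) (A K : V) : Prop :=
  K ⊆ power A /\ ∅ ∈ K /\
  forall B a, B ∈ K -> a ∈ A -> a ∉ B -> B ∪ singleton a ∈ K.

Definition finite (V : zf_universe) (A : V) : Prop :=
  forall K, inductive_system A K <-> K = power A.

Lemma mem_adjoin (V : zf_universe) (A a x : V) :
  x ∈ A ∪ singleton a <-> x ∈ A \/ x = a.
Proof.
unfold union, singleton; rewrite mem_bigunion; split.
- intros [y [Hy Hx]]; apply mem_pair in Hy; destruct Hy as [-> | ->].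
  + now left.
  + apply mem_pair in Hx; tauto.
- intros [Hx | ->].
  + exists A; rewrite mem_pair; tauto.
  + exists (pair a a); rewrite !mem_pair; tauto.
Qed.

Lemma adjoin_id (V : zf_universe) (A a : V) : a ∈ A -> A ∪ singleton a = A.
Proof.
intros Ha; apply extensionality; intros x; rewrite mem_adjoin.
split; [intros [H | ->] | ]; auto.
Qed.

Lemma inductive_system_power (V : zf_universe) (A : V) :
  inductive_system A (power A).
Proof.
split; [now auto | split].
- apply mem_power; intros x Hx; now apply mem_empty in Hx.
- intros B a HB Ha _; rewrite mem_power in *.
  intros x Hx; apply mem_adjoin in Hx; destruct Hx as [Hx | ->]; auto.
Qed.

Lemma finite_intro (V : zf_universe) (A : V) :
  (forall K, inductive_system A K -> power A ⊆ K) -> finite A.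
Proof.
intros H K; split.
- intros HK; apply extensionality; intros x; split.
  + now apply HK.
  + now apply H.
- intros ->; apply inductive_system_power.
Qed.

Lemma finite_ind (V : zf_universe) (A : V) (P : V -> Prop) :
  finite A -> P ∅ ->
  (forall B a, B ⊆ A -> P B -> a ∈ A -> a ∉ B -> P (B ∪ singleton a)) ->
  forall B, B ⊆ A -> P B.
Proof.
intros HA P0 PS.
assert (HK : inductive_system A (separation (power A) P)).
{ destruct (inductive_system_power A) as [_ [E S]]; split; [ | split].
  - now intros B HB; apply mem_separation in HB.
  - now apply mem_separation.
  - intros B a HB Ha HaB; apply mem_separation in HB.
    destruct HB as [HB PB]; apply mem_separation; split.
    + now apply S.
    + apply PS; auto; now apply mem_power. }
apply HA in HK; intros B HB.
apply mem_power in HB; rewrite <- HK in HB; now apply mem_separation in HB.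
Qed.

Lemma finite_empty (V : zf_universe) : finite (∅ : V).
Proof.
apply finite_intro; intros K [_ [K0 _]] B HB.
replace B with (∅ : V); [exact K0 | ].
apply extensionality; intros x; split; intros Hx.
- now apply mem_empty in Hx.
- rewrite mem_power in HB; now apply HB.
Qed.

Lemma finite_adjoin (V : zf_universe) (A a : V) :
  finite A -> finite (A ∪ singleton a).
Proof.
intros HA; apply finite_intro; intros K [_ [K0 KS]].
assert (K1 : forall B, B ⊆ A -> B ∈ K).
{ apply (finite_ind HA); [exact K0 | ].
  intros B b _ HB Hb HbB; apply KS; auto; apply mem_adjoin; auto. }
assert (K2 : forall B, B ⊆ A -> B ∪ singleton a ∈ K).
{ intros B HB; destruct (classic (a ∈ B)) as [HaB | HaB].
  - rewrite adjoin_id; auto.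
  - apply KS; auto; apply mem_adjoin; auto. }
intros C HC; rewrite mem_power in HC.
destruct (classic (a ∈ C)) as [HaC | HaC].
- replace C with (separation C (fun x => x ∈ A) ∪ singleton a).
  + apply K2; intros x Hx; now apply mem_separation in Hx.
  + apply extensionality; intros x; rewrite mem_adjoin, mem_separation; split.
    * intros [[Hx _] | ->]; auto.
    * intros Hx; specialize (HC x Hx); apply mem_adjoin in HC; tauto.
- apply K1; intros x Hx; specialize (HC x Hx); apply mem_adjoin in HC.
  destruct HC as [HC | ->]; [exact HC | contradiction].
Qed.

(* The elements of a set, as a type; functions El X -> El Y are mappings
   from X to Y. *)
Definition El (V : zf_universe) (X : V) : Type := {x : V | x ∈ X}.

Definition finite_set (V : zf_universe) : Type := {A : V | finite A}.

Definition fset_empty (V : zf_universe) : finite_set V :=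
  exist _ ∅ (@finite_empty V).

Arguments fset_empty V : clear implicits.

Definition fset_adjoin (V : zf_universe) (A : finite_set V) (a : V) :
    finite_set V :=
  exist _ (proj1_sig A ∪ singleton a) (finite_adjoin a (proj2_sig A)).

Definition is_iterator (V : zf_universe) (X : V) (f : El X -> El X)
    (x0 : El X) (num : finite_set V -> El X) : Prop :=
  num (fset_empty V) = x0 /\
  forall (A : finite_set V) (a : V),
    a ∉ proj1_sig A -> num (fset_adjoin A a) = f (num A).

(* Main.v *)
(** Iterators are built locally, on the subsets of a finite set [A], by
    induction on [A]. An iterator [u] on the subsets of [A] extends to the
    subsets of [A ∪ {a}], where [a ∉ A], by letting [u' B = f (u (B \ {a}))]
    when [a ∈ B]; the recursion is preserved because adding some [b <> a]
    commutes with removing [a]. Local iterators agree wherever both are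
    defined, so taking the value at [A] of any iterator on the subsets of [A]
    gives the global one. *)
Require Import Defs.
From Stdlib Require Import ClassicalEpsilon FunctionalExtensionality.

Set Implicit Arguments.
Unset Strict Implicit.

Definition remove (V : zf_universe) (A : V) (a : V) : V :=
  separation A (fun x => x <> a).

Lemma mem_remove (V : zf_universe) (A a x : V) :
  x ∈ remove A a <-> x ∈ A /\ x <> a.
Proof. apply mem_separation. Qed.

Lemma remove_adjoin_same (V : zf_universe) (A a : V) :
  a ∉ A -> remove (A ∪ singleton a) a = A.
Proof.
intros Ha; apply extensionality; intros x.
rewrite mem_remove, mem_adjoin; split.
- tauto.
- intros Hx; split; [tauto | now intros ->].
Qed.

Lemma remove_adjoin_other (V : zf_universe) (A a b : V) :
  b <> a -> remove (A ∪ singleton b) a = remove A a ∪ singleton b.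
Proof.
intros Hba; apply extensionality; intros x.
rewrite mem_remove, !mem_adjoin, mem_remove; split.
- tauto.
- intros [Hx | ->]; tauto.
Qed.

Lemma subset_adjoin_notin (V : zf_universe) (A B a : V) :
  B ⊆ A ∪ singleton a -> a ∉ B -> B ⊆ A.
Proof.
intros HB Ha x Hx; specialize (HB x Hx); apply mem_adjoin in HB.
destruct HB as [HB | ->]; [exact HB | contradiction].
Qed.

Lemma remove_subset (V : zf_universe) (A B a : V) :
  B ⊆ A ∪ singleton a -> remove B a ⊆ A.
Proof.
intros HB x Hx; apply mem_remove in Hx; destruct Hx as [Hx Hxa].
specialize (HB x Hx); apply mem_adjoin in HB; tauto.
Qed.

(** Here [u] is total on [V], so no finiteness or subset proofs enter its argument; its values off
    the subsets of [A] are arbitrary. *)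
Definition local_iterator (V : zf_universe) (T : Type) (f : T -> T) (x0 : T)
    (A : V) (u : V -> T) : Prop :=
  u ∅ = x0 /\
  forall B a, B ⊆ A -> a ∈ A -> a ∉ B -> u (B ∪ singleton a) = f (u B).

Lemma local_iterator_mono (V : zf_universe) (T : Type) (f : T -> T) (x0 : T)
    (A B : V) (u : V -> T) :
  A ⊆ B -> local_iterator f x0 B u -> local_iterator f x0 A u.
Proof. intros HAB [u0 uS]; split; [exact u0 | auto]. Qed.

Lemma local_iterator_unique (V : zf_universe) (T : Type) (f : T -> T) (x0 : T)
    (A : V) (u v : V -> T) :
  finite A -> local_iterator f x0 A u -> local_iterator f x0 A v ->
  forall B, B ⊆ A -> u B = v B.
Proof.
intros HA [u0 uS] [v0 vS]; apply (finite_ind HA).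
- now rewrite u0, v0.
- intros B a HB E Ha HaB; rewrite uS, vS by assumption; now rewrite E.
Qed.

Lemma local_iterator_adjoin (V : zf_universe) (T : Type) (f : T -> T) (x0 : T)
    (A a : V) (u : V -> T) :
  a ∉ A -> local_iterator f x0 A u ->
  local_iterator f x0 (A ∪ singleton a)
    (fun B => if excluded_middle_informative (a ∈ B)
              then f (u (remove B a)) else u B).
Proof.
intros HaA [u0 uS]; split.
- destruct (excluded_middle_informative _) as [H | _]; [ | exact u0].
  now apply mem_empty in H.
- intros B b HB Hb HbB.
  destruct (excluded_middle_informative (a ∈ B ∪ singleton b)) as [H | H];
    rewrite mem_adjoin in H;
    destruct (excluded_middle_informative (a ∈ B)) as [HaB | HaB].
  (* Both sides use the new branch: removing [a] first turns this into the recursion of [u] at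
     [remove B a]. *)
  + assert (Hba : b <> a) by now intros ->.
    rewrite remove_adjoin_other by exact Hba; rewrite uS; auto.
    * now apply remove_subset.
    * apply mem_adjoin in Hb; tauto.
    * rewrite mem_remove; tauto.
  (* Here [b = a]: the new branch at [B ∪ singleton a] strips [a] off again and returns
     [f (u B)]. *)
  + destruct H as [H | <-]; [contradiction | ].
    now rewrite remove_adjoin_same.
  + tauto.
  + apply uS; auto.
    * now apply subset_adjoin_notin with a.
    * apply mem_adjoin in Hb; destruct Hb as [Hb | ->]; tauto.
Qed.

Lemma local_iterator_exists (V : zf_universe) (T : Type) (f : T -> T) (x0 : T)
    (A : V) :
  finite A -> exists u, local_iterator f x0 A u.
Proof.
intros HA.
apply (finite_ind (P := fun B => exists u, local_iterator f x0 B u) HA); auto.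
(* Over [∅] there is nothing to adjoin, so a constant function suffices. *)
- exists (fun _ => x0); split; [reflexivity | ].
  intros B a _ Ha; now apply mem_empty in Ha.
- intros B a _ [u Hu] _ HaB; eexists; now apply local_iterator_adjoin, Hu.
Qed.

Lemma finite_set_eq (V : zf_universe) (A B : finite_set V) :
  proj1_sig A = proj1_sig B -> A = B.
Proof. apply eq_sig_hprop; intros; apply proof_irrelevance. Qed.

(** [finite_ind] stays below one fixed finite set and concerns bare sets; this form reaches all
    finite sets, bundled with their finiteness proofs. *)
Lemma finite_set_ind (V : zf_universe) (P : finite_set V -> Prop) :
  P (fset_empty V) ->
  (forall (A : finite_set V) a, P A -> a ∉ proj1_sig A -> P (fset_adjoin A a)) ->
  forall A, P A.
Proof.
intros P0 PS [A HA].
(* The existential hides the finiteness proof, giving a predicate on [V]; proof irrelevance then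
   identifies [A'] with the given finite set. *)
assert (H : exists A', proj1_sig A' = A /\ P A').
{ apply (finite_ind (P := fun B => exists B', proj1_sig B' = B /\ P B') HA);
    auto.
  - now exists (fset_empty V).
  - intros B a _ [B' [<- HB']] _ Ha; exists (fset_adjoin B' a); auto. }
destruct H as [A' [E PA']].
assert (EA : A' = exist _ A HA) by now apply finite_set_eq.
rewrite EA in PA'; exact PA'.
Qed.

Lemma is_iterator_unique (V : zf_universe) (X : V) (f : El X -> El X)
    (x0 : El X) (num num' : finite_set V -> El X) :
  is_iterator f x0 num -> is_iterator f x0 num' -> num = num'.
Proof.
intros [num0 numS] [num0' numS']; apply functional_extensionality.
apply finite_set_ind.
- now rewrite num0, num0'.
- intros A a IH Ha; rewrite numS, numS' by exact Ha; now rewrite IH.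
Qed.

Lemma is_iterator_exists (V : zf_universe) (X : V) (f : El X -> El X)
    (x0 : El X) :
  exists num, is_iterator f x0 num.
Proof.
(* Choice picks a local iterator for each finite set separately, with no coherence built in. *)
pose (u := fun A : finite_set V => constructive_indefinite_description _
  (local_iterator_exists f x0 (proj2_sig A))).
exists (fun A => proj1_sig (u A) (proj1_sig A)); split.
- apply (proj2_sig (u (fset_empty V))).
- intros A a Ha.
  assert (Hsub : proj1_sig A ⊆ proj1_sig A ∪ singleton a)
    by (intros x Hx; apply mem_adjoin; auto).
  pose proof (proj2_sig (u (fset_adjoin A a))) as HAa.
  (* The iterator chosen for [A] is replaced at [A] by the one chosen for [A ∪ singleton a], whose
     own recursion then closes the goal. *)
  rewrite (local_iterator_unique (proj2_sig A) (proj2_sig (u A))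
    (local_iterator_mono Hsub HAa) (fun x Hx => Hx)).
  apply HAa; auto; apply mem_adjoin; auto.
Qed.

Theorem theorem3p1 (V : zf_universe) (X : V) (f : El X -> El X) (x0 : El X) :
  exists! num : finite_set V -> El X, is_iterator f x0 num.
Proof.
destruct (is_iterator_exists f x0) as [num Hnum].
exists num; split; [exact Hnum | ].
intros num'; now apply is_iterator_unique.
Qed.
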